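(* Let $A=\begin{pmatrix}a&b\\c&d\end{pmatrix}\in\mathrm{GL}(2,\mathbb Z)$ and let $F_\Phi$ be a quaternionic lift of $A$. Then for every unit purely imaginary quaternion $I$ the torus $\mathbb T_I^2=S_I^1\times S_I^1\subset\mathrm{SU}(2)^2$ is invariant under $F_\Phi$ and, in the angular coordinates $(\theta_1,\theta_2)\leftrightarrow(e^{I\theta_1},e^{I\theta_2})$, $$F_\Phi|_{\mathbb T_I^2}(\theta_1,\theta_2)=A\begin{pmatrix}\theta_1\\\theta_2\end{pmatrix}\pmod{2\pi\mathbb Z^2}.$$
   Context: $\mathrm{SU}(2)$ is identified with the group of unit quaternions. For a unit purely imaginary quaternion $I$, $S_I^1=\{e^{I\theta}:\theta\in\mathbb R\}$ with $e^{I\theta}=\cos\theta+I\sin\theta$. $F_2=\langle x,y\rangle$ is the free group. For $\Phi\in\operatorname{Aut}(F_2)$, $F_\Phi:\mathrm{SU}(2)^2\to\mathrm{SU}(2)^2$ is $F_\Phi(q_1,q_2)=(\Phi(x)(q_1,q_2),\Phi(y)(q_1,q_2))$, where $w(q_1,q_2)$ denotes substitution of $q_1$ for $x$ and $q_2$ for $y$ in a word $w$. The row exponent matrix $\mathrm R(\Phi)$ has first row the exponent sums (in $x$ and in $y$) of $\Phi(x)$ and second row those of $\Phi(y)$. A quaternionic lift of $A$ is a map $F_\Phi$ with $\mathrm R(\Phi)=A$. *)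

(* Defs.v *)
From HB Require Import structures.
From mathcomp Require Import all_boot all_order all_algebra.
From mathcomp Require Import all_classical all_reals all_analysis.
From mathcomp Require Import ring.

Set Implicit Arguments.
Unset Strict Implicit.
Unset Printing Implicit Defensive.

Import Order.TTheory GRing.Theory Num.Theory.
Import numFieldNormedType.Exports.

Local Open Scope classical_set_scope.
Local Open Scope ring_scope.

(* The free group on X, as the reduced words over X and its formal inverses:
   the letter (i, false) stands for i, and (i, true) for i^-1. *)
Section FreeGroup.
Context (X : choiceType).
Implicit Types (l : X * bool) (s w : seq (X * bool)).

Definition inv_letter l : X * bool := (l.1, ~~ l.2).

Definition reduced w := sorted (fun l1 l2 => l2 != inv_letter l1) w.

Definition cons_reduce l s :=
  if s is l' :: s' then (if l' == inv_letter l then s' else l :: s)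
  else [:: l].

Definition reduce w := foldr cons_reduce [::] w.

Lemma inv_letterK : involutive inv_letter.
Proof. by case=> i b; rewrite /inv_letter /= negbK. Qed.

Lemma cons_reduce_reduced l s : reduced s -> reduced (cons_reduce l s).
Proof.
case: s => [|l' s] //= rs; case: ifP => [_|/negbT nl /=]; last by rewrite nl.
exact: path_sorted rs.
Qed.

Lemma reduce_reduced w : reduced (reduce w).
Proof. by elim: w => //= l w; apply: cons_reduce_reduced. Qed.

Lemma cons_reduceK l s :
  reduced s -> cons_reduce l (cons_reduce (inv_letter l) s) = s.
Proof.
case: s => [|l' s] /= rs; first by rewrite eqxx.
rewrite inv_letterK; case: eqP rs => [->|_] rs /=; last by rewrite eqxx.
by case: s rs => //= l'' s /andP[/negPf ->].
Qed.

Lemma foldr_cons_reduce s w :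
  reduced s -> reduced (foldr cons_reduce s w).
Proof. by move=> rs; elim: w => //= l w; apply: cons_reduce_reduced. Qed.

Lemma foldr_reduce s w : reduced s ->
  foldr cons_reduce s (reduce w) = foldr cons_reduce s w.
Proof.
move=> rs; elim: w => //= l w <-; move: (reduce w) => [|l' t] //=.
case: eqP => // ->; rewrite cons_reduceK //; exact: foldr_cons_reduce.
Qed.

Lemma reduce_id w : reduced w -> reduce w = w.
Proof.
elim: w => //= l w IHw rw; rewrite IHw; last exact: path_sorted rw.
by case: w rw {IHw} => //= l' w /andP[/negPf ->].
Qed.

Lemma reduce_catl w1 w2 : reduce (reduce w1 ++ w2) = reduce (w1 ++ w2).
Proof. by rewrite /reduce !foldr_cat foldr_reduce ?reduce_reduced. Qed.

Lemma reduce_catr w1 w2 : reduce (w1 ++ reduce w2) = reduce (w1 ++ w2).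
Proof.
by rewrite /reduce !foldr_cat -/(reduce _) reduce_id ?reduce_reduced.
Qed.

Definition inv_word w := map inv_letter (rev w).

Lemma reduce_inv_word w : reduce (w ++ inv_word w) = [::].
Proof.
elim: w => //= l w; rewrite /inv_word rev_cons map_rcons -cats1 catA => IHw.
by rewrite -reduce_catl IHw /= eqxx.
Qed.

Lemma inv_wordK : involutive inv_word.
Proof.
by move=> w; rewrite /inv_word -map_rev revK -map_comp map_id_in // => l _;
   rewrite /= inv_letterK.
Qed.

Record free_group := FreeGroup { word :> seq (X * bool); _ : reduced word }.

HB.instance Definition _ := [isSub for word].
HB.instance Definition _ := [Choice of free_group by <:].

Definition mk_word w : free_group := FreeGroup (reduce_reduced w).

Definition fg_one := mk_word [::].
Definition fg_mul (u v : free_group) := mk_word (u ++ v).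
Definition fg_inv (u : free_group) := mk_word (inv_word u).

Lemma fg_mulA : associative fg_mul.
Proof.
by move=> u v w; apply: val_inj; rewrite /= reduce_catl reduce_catr catA.
Qed.

Lemma fg_mul1 : left_id fg_one fg_mul.
Proof. by move=> u; apply: val_inj; rewrite /= reduce_id //; case: u. Qed.

Lemma fg_mulr1 : right_id fg_one fg_mul.
Proof.
by move=> u; apply: val_inj; rewrite /= cats0 reduce_id //; case: u.
Qed.

Lemma fg_mulV : left_inverse fg_one fg_inv fg_mul.
Proof.
move=> u; apply: val_inj => /=; rewrite reduce_catl.
by rewrite -{2}[word u]inv_wordK reduce_inv_word.
Qed.

Lemma fg_mulrV : right_inverse fg_one fg_inv fg_mul.
Proof.
by move=> u; apply: val_inj => /=; rewrite reduce_catr reduce_inv_word.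
Qed.

HB.instance Definition _ :=
  isGroup.Build free_group fg_mulA fg_mul1 fg_mulr1 fg_mulV fg_mulrV.

Definition fg_gen (i : X) : free_group := mk_word [:: (i, false)].

Definition fg_subst (G : groupType) (g : X -> G) (w : free_group) : G :=
  (\prod_(l <- word w) (if l.2 then (g l.1)^-1 else g l.1))%g.

Definition exponent_sum (i : X) (w : free_group) : int :=
  \sum_(l <- word w | l.1 == i) (if l.2 then -1 else 1).

End FreeGroup.

Record group_aut (G : groupType) := GroupAut {
  aut_fun :> {multiplicative G -> G};
  aut_bij : bijective aut_fun }.

Notation F2 := (free_group 'I_2).
Notation AutF2 := (group_aut F2).

Definition F2x : F2 := fg_gen (0 : 'I_2).
Definition F2y : F2 := fg_gen (1 : 'I_2).

Definition row_exponent_matrix (Phi : AutF2) : 'M[int]_2 :=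
  \matrix_(i < 2, j < 2) exponent_sum j (Phi (if i == 0 then F2x else F2y)).

(* w(q1, q2) *)
Definition subst2 (G : groupType) (w : F2) (q : G * G) : G :=
  fg_subst (fun i : 'I_2 => if i == 0 then q.1 else q.2) w.

(* quat a b c d is a + b i + c j + d k. *)
Record quat (R : realType) := Quat { qa : R; qb : R; qc : R; qd : R }.

Section Quaternions.
Context (R : realType).
Local Notation H := (quat R).
Implicit Types (p q : H).

Lemma quat_eqP p q :
  qa p = qa q -> qb p = qb q -> qc p = qc q -> qd p = qd q -> p = q.
Proof. by case: p => a b c d; case: q => ? ? ? ? /= -> -> -> ->. Qed.

Definition quat_to_prod q := (qa q, qb q, qc q, qd q).
Definition quat_of_prod (x : R * R * R * R) :=
  let: (a, b, c, d) := x in Quat a b c d.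
Lemma quat_to_prodK : cancel quat_to_prod quat_of_prod.
Proof. by case. Qed.

HB.instance Definition _ := Choice.copy (quat R) (can_type quat_to_prodK).

Definition quat_zero : H := Quat 0 0 0 0.
Definition quat_opp q : H := Quat (- qa q) (- qb q) (- qc q) (- qd q).
Definition quat_add p q : H :=
  Quat (qa p + qa q) (qb p + qb q) (qc p + qc q) (qd p + qd q).

Lemma quat_addA : associative quat_add.
Proof. by move=> p q r; apply: quat_eqP; rewrite /= addrA. Qed.
Lemma quat_addC : commutative quat_add.
Proof. by move=> p q; apply: quat_eqP; rewrite /= addrC. Qed.
Lemma quat_add0 : left_id quat_zero quat_add.
Proof. by move=> p; apply: quat_eqP; rewrite /= add0r. Qed.
Lemma quat_addN : left_inverse quat_zero quat_opp quat_add.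
Proof. by move=> p; apply: quat_eqP; rewrite /= addNr. Qed.

HB.instance Definition _ :=
  GRing.isZmodule.Build (quat R) quat_addA quat_addC quat_add0 quat_addN.

Definition quat_one : H := Quat 1 0 0 0.
Definition quat_mul p q : H :=
  Quat (qa p * qa q - qb p * qb q - qc p * qc q - qd p * qd q)
       (qa p * qb q + qb p * qa q + qc p * qd q - qd p * qc q)
       (qa p * qc q - qb p * qd q + qc p * qa q + qd p * qb q)
       (qa p * qd q + qb p * qc q - qc p * qb q + qd p * qa q).

Lemma quat_mulA : associative quat_mul.
Proof. by move=> p q r; apply: quat_eqP => /=; ring. Qed.
Lemma quat_mul1 : left_id quat_one quat_mul.
Proof. by move=> q; apply: quat_eqP => /=; ring. Qed.
Lemma quat_mulr1 : right_id quat_one quat_mul.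
Proof. by move=> q; apply: quat_eqP => /=; ring. Qed.
Lemma quat_mulDl : left_distributive quat_mul quat_add.
Proof. by move=> p q r; apply: quat_eqP => /=; ring. Qed.
Lemma quat_mulDr : right_distributive quat_mul quat_add.
Proof. by move=> p q r; apply: quat_eqP => /=; ring. Qed.
Lemma quat_one_neq0 : quat_one != 0 :> H.
Proof. by apply/eqP => -[] /eqP; rewrite oner_eq0. Qed.

HB.instance Definition _ := GRing.Zmodule_isNzRing.Build (quat R)
  quat_mulA quat_mul1 quat_mulr1 quat_mulDl quat_mulDr quat_one_neq0.

Definition quat_scale (t : R) q : H :=
  Quat (t * qa q) (t * qb q) (t * qc q) (t * qd q).

Lemma quat_scaleA (s t : R) q :
  quat_scale s (quat_scale t q) = quat_scale (s * t) q.
Proof. by apply: quat_eqP => /=; ring. Qed.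
Lemma quat_scale1 : left_id 1 quat_scale.
Proof. by move=> q; apply: quat_eqP => /=; ring. Qed.
Lemma quat_scaleDr : right_distributive quat_scale +%R.
Proof. by move=> t p q; apply: quat_eqP => /=; ring. Qed.
Lemma quat_scaleDl q : {morph quat_scale^~ q : s t / s + t >-> s + t}.
Proof. by move=> s t; apply: quat_eqP => /=; ring. Qed.

HB.instance Definition _ := GRing.Zmodule_isLmodule.Build R (quat R)
  quat_scaleA quat_scale1 quat_scaleDr quat_scaleDl.

Definition quat_conj q : H := Quat (qa q) (- qb q) (- qc q) (- qd q).

Definition quat_norm q : R :=
  Num.sqrt (qa q ^+ 2 + qb q ^+ 2 + qc q ^+ 2 + qd q ^+ 2).

Lemma quat_normM p q : quat_norm (p * q) = quat_norm p * quat_norm q.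
Proof.
rewrite /quat_norm -sqrtrM ?addr_ge0 ?sqr_ge0 //.
by congr Num.sqrt => /=; ring.
Qed.

Lemma quat_norm1 : quat_norm 1 = 1.
Proof. by rewrite /quat_norm /= !(expr0n, expr1n) !addr0 sqrtr1. Qed.

Lemma quat_norm_conj q : quat_norm (quat_conj q) = quat_norm q.
Proof. by rewrite /quat_norm /= !sqrrN. Qed.

Lemma quat_norm_eq1 q : quat_norm q = 1 ->
  qa q ^+ 2 + qb q ^+ 2 + qc q ^+ 2 + qd q ^+ 2 = 1.
Proof.
move=> q1; rewrite -[LHS]sqr_sqrtr ?addr_ge0 ?sqr_ge0 //.
by rewrite -/(quat_norm q) q1 expr1n.
Qed.

End Quaternions.

Record SU2 (R : realType) := UnitQuat {
  su2_quat :> quat R;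
  _ : quat_norm su2_quat == 1 }.

Section SU2Group.
Context (R : realType).

HB.instance Definition _ := [isSub for @su2_quat R].
HB.instance Definition _ := [Choice of SU2 R by <:].

Lemma su2_norm (p : SU2 R) : quat_norm p = 1.
Proof. by apply/eqP; case: p. Qed.

Lemma su2_one_subproof : quat_norm (1 : quat R) == 1.
Proof. by rewrite quat_norm1. Qed.
Definition su2_one : SU2 R := UnitQuat su2_one_subproof.

Lemma su2_mul_subproof (p q : SU2 R) :
  quat_norm (su2_quat p * su2_quat q) == 1.
Proof. by rewrite quat_normM !su2_norm mulr1. Qed.
Definition su2_mul (p q : SU2 R) : SU2 R := UnitQuat (su2_mul_subproof p q).

Lemma su2_inv_subproof (p : SU2 R) : quat_norm (quat_conj p) == 1.
Proof. by rewrite quat_norm_conj su2_norm. Qed.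
Definition su2_inv (p : SU2 R) : SU2 R := UnitQuat (su2_inv_subproof p).

Lemma su2_mulA : associative su2_mul.
Proof. by move=> p q r; apply: val_inj; rewrite /= mulrA. Qed.
Lemma su2_mul1 : left_id su2_one su2_mul.
Proof. by move=> p; apply: val_inj; rewrite /= mul1r. Qed.
Lemma su2_mulr1 : right_id su2_one su2_mul.
Proof. by move=> p; apply: val_inj; rewrite /= mulr1. Qed.
Lemma su2_mulV : left_inverse su2_one su2_inv su2_mul.
Proof.
move=> p; apply: val_inj; have /quat_norm_eq1 p1 := su2_norm p.
by apply: quat_eqP => /=; [rewrite -[RHS]p1| | |]; ring.
Qed.
Lemma su2_mulrV : right_inverse su2_one su2_inv su2_mul.
Proof.
move=> p; apply: val_inj; have /quat_norm_eq1 p1 := su2_norm p.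
by apply: quat_eqP => /=; [rewrite -[RHS]p1| | |]; ring.
Qed.

HB.instance Definition _ := isGroup.Build (SU2 R)
  su2_mulA su2_mul1 su2_mulr1 su2_mulV su2_mulrV.

End SU2Group.

Record imag_unit (R : realType) := ImagUnit {
  imag_quat :> quat R;
  imag_re0 : qa imag_quat = 0;
  imag_norm1 : quat_norm imag_quat = 1 }.

Section Tori.
Context (R : realType).
Implicit Types (I : imag_unit R).

Lemma expI_subproof I (t : R) :
  quat_norm ((cos t) *: (1 : quat R) + (sin t) *: (I : quat R)) == 1.
Proof.
case: I => q q0 /quat_norm_eq1 /= q1.
rewrite /quat_norm /= q0 -[eqbRHS]sqrtr1; apply/eqP; congr Num.sqrt.
rewrite -[RHS](cos2Dsin2 t) -[in RHS](mulr1 (sin t ^+ 2)) -[in RHS]q1 q0.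
ring.
Qed.

(* e^{I t} = cos t + I sin t *)
Definition expI I (t : R) : SU2 R := UnitQuat (expI_subproof I t).

Definition circle I : set (SU2 R) := range (expI I).

Definition torus I : set (SU2 R * SU2 R) := circle I `*` circle I.

Definition torus_point I (theta : 'cV[R]_2) : SU2 R * SU2 R :=
  (expI I (theta 0 0), expI I (theta 1 0)).

Definition eqmod_2pi n (u v : 'cV[R]_n) : Prop :=
  exists k : 'cV[int]_n, u - v = (2 * pi) *: map_mx intr k.

End Tori.

Definition quat_map (R : realType) (Phi : AutF2) (q : SU2 R * SU2 R) :
    SU2 R * SU2 R :=
  (subst2 (Phi F2x) q, subst2 (Phi F2y) q).

Definition quaternionic_lift (R : realType) (A : 'M[int]_2)
    (F : SU2 R * SU2 R -> SU2 R * SU2 R) : Prop :=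
  exists2 Phi : AutF2, row_exponent_matrix Phi = A & F = quat_map Phi.

(* Main.v *)
Require Import Defs.
From mathcomp Require Import all_boot all_order all_algebra.
From mathcomp Require Import all_classical all_reals all_analysis.
From mathcomp Require Import ring lra.

Import Order.TTheory GRing.Theory Num.Theory.

Set Implicit Arguments.
Unset Strict Implicit.

Local Open Scope classical_set_scope.
Local Open Scope ring_scope.

(** On the torus of [I] both substituted quaternions lie in the abelian
    one-parameter group [t |-> e^{It}], so a word only sees its exponent sums:
    [w(e^{I t1}, e^{I t2}) = e^{I (m t1 + n t2)}]. The kernel of that
    one-parameter group is [2 pi Z], which gives the formula modulo
    [2 pi Z^2]; invertibility of [A] gives surjectivity onto the torus. *)

Lemma periodicz (U V : zmodType) (f : U -> V) (T : U) :
  periodic f T -> forall (k : int) a, f (a + T *~ k) = f a.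
Proof.
move=> fT [n|n] a; first exact: periodicn.
(* For a negative multiple, forward periodicity is applied from the shifted point
   [a - T *~ n.+1]. *)
by rewrite NegzE mulrNz -[in RHS](subrK (T *~ n.+1) a) [RHS]periodicn.
Qed.

(** Identifies the kernel of [expI I]. Taking the floor of [x / (2 * pi)] leaves a remainder [r] in
    [[0, 2 pi)], which a half-angle argument forces to vanish. *)
Lemma cos_eq1 (R : realType) (x : R) :
  cos x = 1 <-> exists k : int, x = (2 * pi) * k%:~R.
Proof.
split=> [cx1|[k ->]]; last first.
  by rewrite mulrzr mulr_natl -[_ *~ k]add0r (periodicz (@cosD2pi R)) cos0.
pose k := Num.floor (x / (2 * pi)); exists k.
have p0 : 0 < 2 * pi :> R by rewrite mulr_gt0 ?pi_gt0.
have /andP[kx xk] : k%:~R <= x / (2 * pi) < (k + 1)%:~R.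
  exact: Num.Theory.floor_itv.
have {}kx : 2 * pi * k%:~R <= x by rewrite mulrC -ler_pdivlMr.
have {}xk : x < 2 * pi * k%:~R + 2 * pi.
  by move: xk; rewrite ltr_pdivrMr // intrD mulrDl mul1r mulrC.
pose r := x - 2 * pi * k%:~R.
have cr : cos r = 1.
  by rewrite -(periodicz (@cosD2pi R) k) -mulr_natl -mulrzr subrK.
(* From [cos r = 1 - 2 sin(r/2)^2]. *)
have sr : sin (r / 2) = 0.
  have : cos ((r / 2) *+ 2) = 1 by rewrite -[_ *+ 2]mulr_natr divfK.
  rewrite cos_mulr2n cos2sin2 => h; apply/eqP; rewrite -sqrf_eq0; apply/eqP.
  lra.
(* If [r <= 0], the floor bound gives [r = 0]; otherwise [r / 2] lies in [(0, pi)], where the sine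
   is positive. *)
have [r0|] := ltP 0 r; last by rewrite /r; lra.
suff : 0 < sin (r / 2) by rewrite sr ltxx.
by apply: sin_gt0_pi; rewrite /r in r0 *; lra.
Qed.

Lemma ord2P (i : 'I_2) : i = 0 \/ i = 1.
Proof. by case: i => [[|[|]]] // ?; [left|right]; apply: val_inj. Qed.

Section Tori.
Context (R : realType) (I : imag_unit R).

Lemma expI0 : expI I 0 = 1%g.
Proof. by apply: val_inj; rewrite /= cos0 sin0 scale1r scale0r addr0. Qed.

(** Zero real part and norm one give [I^2 = -1], so these are the addition formulas for cosine and
    sine. *)
Lemma expID (s t : R) : expI I (s + t) = (expI I s * expI I t)%g.
Proof.
apply: val_inj => /=; rewrite cosD sinD.
have := quat_norm_eq1 (imag_norm1 I); have := imag_re0 I.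
case: (I : quat R) => a b c d /= -> n1.
apply: quat_eqP => /=; try ring.
(* Only the real part uses the norm: [sin s * sin t] is multiplied by [b^2 + c^2 + d^2 = 1]. *)
rewrite -[X in _ - X]mulr1 -[X in _ * _ * X]n1; ring.
Qed.

Lemma expIN (t : R) : expI I (- t) = (expI I t)^-1%g.
Proof.
by apply: (@mulgI _ (expI I t)); rewrite -expID subrr expI0 mulgV.
Qed.

Lemma expI_inj (s t : R) :
  expI I s = expI I t <-> exists k : int, s - t = (2 * pi) * k%:~R.
Proof.
rewrite -cos_eq1; split=> [st|c1].
  have : expI I (s - t) = 1%g.
    by rewrite expID expIN st mulgV.
  move/(congr1 (fun q : SU2 R => qa q)) => /=.
  by rewrite imag_re0 mulr1 mulr0 addr0.
rewrite -[s](subrK t) expID; suff -> : expI I (s - t) = 1%g by rewrite mul1g.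
apply: val_inj => /=.
(* A cosine of absolute value 1 forces the sine to vanish. *)
by rewrite c1 (cos1sin0 _) ?c1 ?normr1 // scale1r scale0r addr0.
Qed.

(** Induction on the list of letters: a new letter changes the exponent sum of its own generator by
    1 or -1 and leaves the others alone. *)
Lemma fg_subst_expI (X : finType) (theta : X -> R) (w : free_group X) :
  fg_subst (fun i => expI I (theta i)) w =
  expI I (\sum_i (exponent_sum i w)%:~R * theta i).
Proof.
rewrite /fg_subst /exponent_sum; elim: (word w) => [|l s IHs].
  rewrite big_nil big1 ?expI0 // => i _; by rewrite big_nil mul0r.
rewrite big_cons IHs.
have -> : (if l.2 then (expI I (theta l.1))^-1%g else expI I (theta l.1)) =
  expI I ((if l.2 then -1 else 1 : int)%:~R * theta l.1).
  by case: l.2; rewrite ?mulN1r ?mul1r // expIN.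
rewrite -expID; congr expI.
(* The term of the generator [l.1] is split off on both sides. *)
rewrite (bigD1 l.1) //= [in RHS](bigD1 l.1) //= addrA.
rewrite big_cons eqxx intrD mulrDl; congr (_ + _).
by apply: eq_bigr => i /negPf il; rewrite big_cons eq_sym il.
Qed.

Lemma subst2_torus_point (w : F2) (theta : 'cV[R]_2) :
  subst2 w (torus_point I theta) =
  expI I (\sum_j (exponent_sum j w)%:~R * theta j 0).
Proof.
rewrite -fg_subst_expI /subst2; congr fg_subst; apply/funext => i.
by case: (ord2P i) => ->.
Qed.

Lemma quat_map_torus_point (Phi : AutF2) (theta : 'cV[R]_2) :
  quat_map Phi (torus_point I theta) =
  torus_point I (map_mx intr (row_exponent_matrix Phi) *m theta).
Proof.
rewrite /quat_map !subst2_torus_point /torus_point !mxE.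
by congr (expI I _, expI I _); apply: eq_bigr => j _; rewrite !mxE.
Qed.

Lemma torus_point_inj (u v : 'cV[R]_2) :
  torus_point I u = torus_point I v <-> eqmod_2pi u v.
Proof.
split=> [uv|[k uv]].
  have /expI_inj[k0 h0] := congr1 fst uv.
  have /expI_inj[k1 h1] := congr1 snd uv.
  exists (\col_i (if i == 0 then k0 else k1)).
  by apply/matrixP => i j; rewrite ord1 !mxE; case: (ord2P i) => ->.
by congr (_, _); apply/expI_inj; [exists (k 0 0)|exists (k 1 0)];
  [move/matrixP/(_ 0 0): uv|move/matrixP/(_ 1 0): uv]; rewrite !mxE.
Qed.

Lemma torusE : torus I = range (torus_point I).
Proof.
apply/seteqP; split=> [[p q] [/= [s _ <-] [t _ <-]]|_ [theta _ <-]].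
  by exists (\col_i (if i == 0 then s else t)); rewrite // /torus_point !mxE.
by split; eexists.
Qed.

End Tori.

Theorem theorem5p1 (R : realType) (A : 'M[int]_2) (A_GL2 : A \in unitmx)
    (F : SU2 R * SU2 R -> SU2 R * SU2 R) (F_lift : quaternionic_lift A F)
    (I : imag_unit R) :
  F @` torus I = torus I /\
  forall theta theta' : 'cV[R]_2,
    F (torus_point I theta) = torus_point I theta' <->
    eqmod_2pi theta' (map_mx intr A *m theta).
Proof.
have [Phi PhiA ->] := F_lift.
have FE theta : quat_map Phi (torus_point I theta) =
    torus_point I (map_mx intr A *m theta).
  by rewrite quat_map_torus_point PhiA.
split=> [|theta theta']; last first.
  by rewrite FE; split=> [/esym/torus_point_inj|/torus_point_inj/esym].
rewrite torusE; apply/seteqP; split=> [_ [_ [theta _ <-] <-]|_ [theta _ <-]].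
  by rewrite FE; exists (map_mx intr A *m theta).
(* The preimage comes from the inverse of [A], again an integer matrix. *)
exists (torus_point I (map_mx intr (invmx A) *m theta)); first by eexists.
by rewrite FE mulmxA -map_mxM mulmxV // map_mx1 mul1mx.
Qed.
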